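(* Let there exist $\phi_0>0$ such that $\phi(t)\ge\phi_0t$ for all $t\ge0$ (or, equivalently, $\liminf_{t\to+0}\phi(t)/t>0$). Then $$\begin{aligned}\mathcal{L}(x,\lambda,\mu,c)&\ge f(x)+\frac c2\phi(\|F(x)\|^2)-\frac{1}{2c\phi_0}+\frac{c}{2b(x)}\left|\max\left\{g(x),-\frac1cp(x,\mu)\mu\right\}\right|^2-\frac{\psi(0)}{2c}+\eta(x,\lambda,\mu)\\&\ge f(x)+\frac c2\phi(\|F(x)\|^2)-\frac{1}{2c\phi_0}+\frac{c}{2\psi(0)}\big|\max\{g(x),0\}\big|^2-\frac{(1+m)\psi(0)}{2c}+\eta(x,\lambda,\mu)\end{aligned}$$ for all $x\in X$, $\lambda\in H$, $\mu\in\mathbb{R}^m$, and $c>0$.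
   Context: Setting. $X$ and $H$ are real Hilbert spaces, $M=\{1,\dots,m\}$, and $f,g_i\colon X\to\mathbb{R}$ ($i\in M$), $F\colon X\to H$ are continuously Fréchet differentiable; $g=(g_1,\dots,g_m)$. $|\cdot|$ is the Euclidean norm; $\max\{y,z\}$ of vectors is taken coordinatewise; $DF(x)[\cdot]\colon X\to H$ is the Fréchet derivative. The function $\phi\colon[0,+\infty)\to[0,+\infty]$ is convex, non-decreasing, lower semicontinuous, $\phi(t)=0$ iff $t=0$, $\mathrm{dom}\,\phi\ne\{0\}$. The function $\psi\colon[0,+\infty)^m\to\mathbb{R}$ is continuously differentiable and concave, $\psi(0)>0$, $0$ is a global maximum point of $\psi$, and $\frac{\partial\psi}{\partial y_i}(y)=0$ whenever $y\in[0,+\infty)^m$, $y_i=0$, $i\in M$. Put $b(x)=\psi(\max\{g(x),0\})$, $p(x,\mu)=b(x)/(1+|\mu|^2)$, $\Omega=\{x\in X\mid b(x)>0,\ \phi(\|F(x)\|^2)<+\infty\}$, $L(x,\lambda,\mu)=f(x)+\langle\lambda,F(x)\rangle+\langle\mu,g(x)\rangle$ for $\lambda\in H$, $\mu\in\mathbb{R}^m$, and $$\eta(x,\lambda,\mu)=\tfrac12\big\|DF(x)[\nabla_xL(x,\lambda,\mu)]\big\|^2+\tfrac12\sum_{i=1}^m\big(\langle\nabla g_i(x),\nabla_xL(x,\lambda,\mu)\rangle+g_i(x)^2\mu_i\big)^2.$$ For $c>0$ the augmented Lagrangian is $$\mathcal{L}(x,\lambda,\mu,c)=f(x)+\langle\lambda,F(x)\rangle+\tfrac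 c2(1+\|\lambda\|^2)\phi(\|F(x)\|^2)+\langle\mu,q\rangle+\tfrac{c}{2p(x,\mu)}|q|^2+\eta(x,\lambda,\mu),\quad q=\max\{g(x),-\tfrac1c p(x,\mu)\mu\},$$ if $x\in\Omega$, and $\mathcal{L}(x,\lambda,\mu,c)=+\infty$ otherwise.
   Formalization: The second inequality is stated only for x with b(x)>0, since the middle expression is undefined at b(x)=0 and the inequality can fail for b(x)<0; the first inequality and the bound of the augmented Lagrangian by the last expression are stated for all x. *)

(* Defs.v *)
From HB Require Import structures.
From mathcomp Require Import all_boot all_order all_algebra.
From mathcomp Require Import all_classical all_reals all_analysis.
Set Implicit Arguments.
Unset Strict Implicit.
Unset Printing Implicit Defensive.
Import Order.TTheory GRing.Theory Num.Theory.
Import numFieldNormedType.Exports.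
Local Open Scope classical_set_scope.
Local Open Scope ring_scope.

(* Real Hilbert spaces: complete normed spaces whose norm comes from an inner
   product. *)
HB.mixin Record CompleteNormedModule_isHilbert (R : realType) X
    & CompleteNormedModule R X := {
  inner : {dot X for (idfun : R -> R)} ;
  inner_sqr_norm : forall u : X, inner u u = `|u| ^+ 2
}.

#[short(type="hilbertType")]
HB.structure Definition Hilbert (R : realType) :=
  {X of CompleteNormedModule R X & CompleteNormedModule_isHilbert R X}.

Notation "''[' u , v ]" := (inner u v) : ring_scope.

(* Continuous Frechet differentiability on the whole space; the second clause
   is continuity of y |-> 'd f y for the operator norm. *)
Definition continuously_differentiable (R : realType) (V W : normedModType R)
    (f : V -> W) : Prop :=
  (forall x, differentiable f x) /\
  (forall x (e : R), 0 < e ->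
     \forall y \near x, forall h : V, `|'d f y h - 'd f x h| <= e * `|h|).

(* The Riesz representative of 'd f x. *)
Definition gradient (R : realType) (X : hilbertType R) (f : X -> R) (x : X) : X :=
  get [set v : X | forall h : X, 'd f x h = '[v, h]].

Section euclidean.
Context {R : realType} {m : nat}.
Implicit Types (u v y z : 'rV[R]_m).

Definition edot u v : R := \sum_(i < m) u 0 i * v 0 i.

(* The library's norm on row vectors is the sup norm. *)
Definition enorm u : R := Num.sqrt (edot u u).

Definition vmax u v : 'rV[R]_m := map2_mx Num.max u v.

Definition orthant : set 'rV[R]_m := [set y | forall i, 0 <= y 0 i].

(* Derivative in the i-th coordinate along increments that stay in the orthant:
   two-sided where y_i > 0, one-sided where y_i = 0. *)
Definition orthant_partial (psi : 'rV[R]_m -> R) (i : 'I_m) y : R :=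
  lim ((fun t : R => t^-1 * (psi (y + t *: delta_mx 0 i) - psi y)) @
       within [set t | orthant (y + t *: delta_mx 0 i)] 0^').

Definition orthant_grad (psi : 'rV[R]_m -> R) y : 'rV[R]_m :=
  \row_(i < m) orthant_partial psi i y.

(* Frechet differentiability relative to the closed orthant, with a derivative
   that is continuous on the orthant. *)
Definition orthant_C1 (psi : 'rV[R]_m -> R) : Prop :=
  (forall y, orthant y -> forall e : R, 0 < e ->
     \forall z \near within orthant (nbhs y),
       `|psi z - psi y - edot (orthant_grad psi y) (z - y)| <= e * `|z - y|) /\
  {within orthant, continuous (orthant_grad psi)}.

(* psi : [0,+oo)^m -> R is represented by a function on the whole of R^m of
   which only the values on the orthant are constrained or used. *)
Record psi_conditions (psi : 'rV[R]_m -> R) : Prop := {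
  psi_C1 : orthant_C1 psi ;
  psi_concave : convex_function orthant (fun y => - psi y) ;
  psi_gt0 : 0 < psi 0 ;
  psi_max0 : forall y, orthant y -> psi y <= psi 0 ;
  psi_partial0 : forall y i, orthant y -> y 0 i = 0 -> orthant_partial psi i y = 0
}.

End euclidean.

Section phi.
Context {R : realType}.
Local Open Scope ereal_scope.

(* Likewise, only the values of phi on [0,+oo) matter. In the convexity
   inequality the endpoint products 0 * +oo are 0. *)
Record phi_conditions (phi : R -> \bar R) : Prop := {
  phi_ge0 : forall t, (0 <= t)%R -> 0 <= phi t ;
  phi_convex : forall s t a, (0 <= s)%R -> (0 <= t)%R -> (0 <= a <= 1)%R ->
    phi (a * s + (1 - a) * t)%R <= a%:E * phi s + (1 - a)%:E * phi t ;
  phi_nondecreasing : forall s t, (0 <= s)%R -> (s <= t)%R -> phi s <= phi t ;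
  phi_lsc : lower_semicontinuous (phi : subspace `[0%R, +oo[ -> \bar R) ;
  phi_eq0 : forall t, (0 <= t)%R -> (phi t = 0 <-> t = 0%R) ;
  phi_dom : [set t | (0 <= t)%R /\ phi t < +oo] <> [set 0%R]
}.

End phi.

Section augmented_lagrangian.
Context {R : realType} {X H : hilbertType R} {m : nat}.
Variables (f : X -> R) (g : 'I_m -> X -> R) (F : X -> H).
Variables (phi : R -> \bar R) (psi : 'rV[R]_m -> R).
Implicit Types (x : X) (lambda : H) (mu : 'rV[R]_m) (c : R).

Definition gvec x : 'rV[R]_m := \row_(i < m) g i x.

Definition bfun x : R := psi (vmax (gvec x) 0).

Definition pfun x mu : R := bfun x / (1 + enorm mu ^+ 2).

Definition Omega : set X := [set x | 0 < bfun x /\ (phi (`|F x| ^+ 2) < +oo)%E].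

Definition lagr x lambda mu : R :=
  f x + '[lambda, F x] + edot mu (gvec x).

Definition grad_lagr x lambda mu : X :=
  gradient (fun y => lagr y lambda mu) x.

Definition eta x lambda mu : R :=
  2^-1 * `|'d F x (grad_lagr x lambda mu)| ^+ 2 +
  2^-1 * \sum_(i < m)
    ('[gradient (g i) x, grad_lagr x lambda mu] + g i x ^+ 2 * mu 0 i) ^+ 2.

Definition qvec x mu c : 'rV[R]_m :=
  vmax (gvec x) (- (c^-1 * pfun x mu) *: mu).

Definition aug_lagr x lambda mu c : \bar R :=
  if x \in Omega then
    ((f x)%:E + ('[lambda, F x])%:E
     + (c / 2 * (1 + `|lambda| ^+ 2))%:E * phi (`|F x| ^+ 2)%R
     + (edot mu (qvec x mu c))%:E
     + (c / (2 * pfun x mu) * enorm (qvec x mu c) ^+ 2)%:E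
     + (eta x lambda mu)%:E)%E
  else +oo%E.

End augmented_lagrangian.

(* Main.v *)
(* Completing the square: if d^2 <= s and a > 0 then a s / 2 + d >= -1/(2a).  By
   Cauchy-Schwarz this applies to d = <lambda, F(x)> with a = c phi0, and to
   d = <mu, q> with a = c / b(x), absorbing the |lambda|^2 phi(|F(x)|^2) and
   |mu|^2 |q|^2 parts of the two penalty terms.  For the second bound,
   |max(g, 0)| <= |max(g, v)| for every v, and b(x) <= psi(0). *)
Require Import Defs.
From mathcomp Require Import all_boot all_order all_algebra.
From mathcomp Require Import all_classical all_reals all_analysis.
From mathcomp Require Import ring lra.
Import Order.TTheory GRing.Theory Num.Theory.
Import numFieldNormedType.Exports.
Local Open Scope classical_set_scope.
Local Open Scope ring_scope.

(** The discriminant argument behind both Cauchy-Schwarz inequalities: for [b > 0], evaluate the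
    quadratic at its minimiser [- (d / b)]; for [b = 0] it is affine in [t], so nonnegativity forces
    [d = 0]. *)
Lemma sqr_le_mul_of_quadratic_ge0 (R : realFieldType) (a b d : R) :
  0 <= b -> (forall t, 0 <= a + 2 * t * d + t ^+ 2 * b) -> d ^+ 2 <= a * b.
Proof.
rewrite le_eqVlt => /predU1P[<-|b_gt0] quad; last first.
  have := quad (- (d / b)).
  have -> : a + 2 * - (d / b) * d + (- (d / b)) ^+ 2 * b = a - d ^+ 2 / b.
    by field; rewrite gt_eqF.
  by rewrite subr_ge0 ler_pdivrMr.
have [->|d_neq0] := eqVneq d 0; first by rewrite expr0n mulr0.
(* This [t] solves [a + 2 * t * d = -1]. *)
have := quad (- (a + 1) / (2 * d)).
have -> : a + 2 * (- (a + 1) / (2 * d)) * d +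
    (- (a + 1) / (2 * d)) ^+ 2 * 0 = -1 by field.
by rewrite ler0N1.
Qed.

Lemma inner_cauchy_schwarz (R : realType) (H : hilbertType R) (u v : H) :
  '[u, v] ^+ 2 <= `|u| ^+ 2 * `|v| ^+ 2.
Proof.
rewrite -!inner_sqr_norm; apply: sqr_le_mul_of_quadratic_ge0 => [|t].
  by rewrite inner_sqr_norm exprn_ge0.
(* Symmetry plus linearity in the second argument suffice to expand the square of [u + t *: v]. *)
have sym (a b : H) : '[a, b] = '[b, a].
  by rewrite (@hermC _ false idfun _ inner a b) expr0 mul1r.
have expand a : '[a, u + t *: v] = '[a, u] + t * '[a, v].
  by rewrite (linearDr inner) (linearZr_LR inner).
have -> : '[u, u] + 2 * t * '[u, v] + t ^+ 2 * '[v, v] =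
    '[u + t *: v, u + t *: v].
  by rewrite expand !(sym (u + _)) !expand (sym v u); ring.
by rewrite inner_sqr_norm exprn_ge0.
Qed.

Section euclidean.
Context {R : realType} {m : nat}.
Implicit Types u v : 'rV[R]_m.

Lemma edot_ge0 u : 0 <= edot u u.
Proof. by apply: sumr_ge0 => i _; rewrite -expr2 sqr_ge0. Qed.

Lemma enorm_sqr u : enorm u ^+ 2 = edot u u.
Proof. by rewrite sqr_sqrtr // edot_ge0. Qed.

Lemma edot_cauchy_schwarz u v : edot u v ^+ 2 <= enorm u ^+ 2 * enorm v ^+ 2.
Proof.
rewrite !enorm_sqr; apply: sqr_le_mul_of_quadratic_ge0 => [|t].
  exact: edot_ge0.
have -> : edot u u + 2 * t * edot u v + t ^+ 2 * edot v v =
    edot (u + t *: v) (u + t *: v).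
  rewrite /edot !mulr_sumr -!big_split /=; apply: eq_bigr => i _.
  by rewrite !mxE; ring.
exact: edot_ge0.
Qed.

Lemma enorm_vmax0_le u v : enorm (vmax u 0) ^+ 2 <= enorm (vmax u v) ^+ 2.
Proof.
rewrite !enorm_sqr; apply: ler_sum => i _; rewrite !mxE -!expr2.
case: (leP (u 0 i) 0) => [_|u_gt0]; first by rewrite expr0n sqr_ge0.
have le_max : u 0 i <= Num.max (u 0 i) (v 0 i) by rewrite le_max lexx.
by rewrite ler_pXn2r // nnegrE ?ltW // (lt_le_trans u_gt0).
Qed.

End euclidean.

Lemma scaled_young (R : realFieldType) (a d s : R) :
  0 < a -> d ^+ 2 <= s -> - (1 / (2 * a)) <= a / 2 * s + d.
Proof.
move=> a_gt0 ds; apply: (@le_trans _ _ (a / 2 * d ^+ 2 + d)); last first.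
  by rewrite lerD2r ler_wpM2l // divr_ge0 // ltW.
rewrite -subr_ge0.
have -> : a / 2 * d ^+ 2 + d - - (1 / (2 * a)) = (a * d + 1) ^+ 2 / (2 * a).
  by field; rewrite gt_eqF.
by rewrite divr_ge0 ?sqr_ge0 // mulr_ge0 // ltW.
Qed.

(** The growth bound keeps the quotient above [phi0] on all of [t > 0], a right neighbourhood of 0.
    Conversely, a positive liminf bounds the quotient below by some [e > 0] on one right
    neighbourhood [V], and convexity carries that bound to every [t]. *)
Lemma growth_iff_liminf_gt0 (R : realType) (phi : R -> \bar R) :
  phi_conditions phi ->
  (exists2 phi0 : R, 0 < phi0 & forall t, 0 <= t -> (phi t >= (phi0 * t)%:E)%E)
  <-> (0 < limf_einf (fun t : R => phi t / t%:E) 0^'+)%E.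
Proof.
move=> phiP; rewrite limf_einfE; split=> [[phi0 phi0_gt0 growth]|].
  apply: (@lt_le_trans _ _ phi0%:E); first by rewrite lte_fin.
  apply: le_trans; last first.
    apply: ereal_sup_ubound; exists [set t : R | 0 < t] => //=.
    exact: nbhs_right_gt.
  apply: le_ereal_inf_tmp => _ [t /= t_gt0 <-].
  rewrite inver gt_eqF // lee_pdivlMr // -EFinM.
  exact/growth/ltW.
move=> /ereal_sup_gt[_ [V V0 <-]] inf_gt0.
have [e e_gt0 e_le] : exists2 e : R, 0 < e &
    forall s, V s -> (e%:E <= phi s / s%:E)%E.
  have lbV s : V s ->
      (ereal_inf ((fun t : R => phi t / t%:E) @` V) <= phi s / s%:E)%E.
    by move=> Vs; apply: ereal_inf_lbound; exists s.
  (* A finite infimum is itself the bound [e]; for [+oo] any positive [e] serves, here 1; [-oo]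
     contradicts [inf_gt0]. *)
  case: (ereal_inf _) inf_gt0 lbV => [r|_|] //; first by exists r.
  by move=> lbV; exists 1 => // s /lbV; apply: le_trans; rewrite leey.
have phi_0 : phi 0 = 0%E by apply/(phi_eq0 phiP).
exists e => // t; rewrite le_eqVlt => /predU1P[<-|t_gt0].
  by rewrite mulr0 phi_0.
(* Convexity and phi 0 = 0 make phi(s)/s nondecreasing, so a single point s of V
   below t suffices. *)
near (0 : R)^'+ => s.
have s_gt0 : 0 < s by near: s; exact: nbhs_right_gt.
have s_lt : s < t by near: s; exact: nbhs_right_lt.
have Vs : V s by near: s.
have st_le1 : 0 <= s / t <= 1.
  by rewrite ler_pdivrMr // mul1r (ltW s_lt) andbT ltW // divr_gt0.
have := phi_convex phiP (ltW t_gt0) (lexx 0) st_le1.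
rewrite mulr0 addr0 divfK ?gt_eqF // phi_0 mule0 adde0 => phis_le.
have := e_le s Vs; rewrite inver gt_eqF // lee_pdivlMr // => es_le.
have := le_trans es_le phis_le.
rewrite -EFinM -lee_pdivrMl ?divr_gt0 // -EFinM.
by have -> : (s / t)^-1 * (e * s) = e * t by field; rewrite !gt_eqF.
Unshelve. all: by end_near.
Qed.

Theorem lemma3p2 (R : realType) (X H : hilbertType R) (m : nat)
    (f : X -> R) (g : 'I_m -> X -> R) (F : X -> H)
    (phi : R -> \bar R) (psi : 'rV[R]_m -> R)
    (f_C1 : continuously_differentiable f)
    (g_C1 : forall i, continuously_differentiable (g i))
    (F_C1 : continuously_differentiable F)
    (phi_cond : phi_conditions phi)
    (psi_cond : psi_conditions psi) :
  ((exists2 phi0 : R, 0 < phi0 & forall t, 0 <= t -> (phi t >= (phi0 * t)%:E)%E)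
   <-> (0 < limf_einf (fun t : R => phi t / t%:E) 0^'+)%E) /\
  forall phi0 : R, 0 < phi0 ->
    (forall t, 0 <= t -> (phi t >= (phi0 * t)%:E)%E) ->
  forall (x : X) (lambda : H) (mu : 'rV[R]_m) (c : R), 0 < c ->
  let L := aug_lagr f g F phi psi x lambda mu c in
  let middle :=
    ((f x)%:E + (c / 2)%:E * phi (`|F x| ^+ 2)%R - (1 / (2 * c * phi0))%:E
     + (c / (2 * bfun g psi x)
        * enorm (vmax (gvec g x) (- (c^-1 * pfun g psi x mu) *: mu)) ^+ 2)%:E
     - (psi 0 / (2 * c))%:E + (eta f g F x lambda mu)%:E)%E in
  let lower :=
    ((f x)%:E + (c / 2)%:E * phi (`|F x| ^+ 2)%R - (1 / (2 * c * phi0))%:E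
     + (c / (2 * psi 0) * enorm (vmax (gvec g x) 0) ^+ 2)%:E
     - ((1 + m%:R) * psi 0 / (2 * c))%:E + (eta f g F x lambda mu)%:E)%E in
  [/\ (L >= middle)%E,
      (0 < bfun g psi x -> (middle >= lower)%E)
    & (L >= lower)%E].
Proof.
split; first exact: growth_iff_liminf_gt0.
move=> phi0 phi0_gt0 growth x lambda mu c c_gt0 L middle lower.
have psi0_gt0 := psi_gt0 psi_cond.
set b := bfun g psi x.
have b_le : b <= psi 0.
  apply: (psi_max0 psi_cond) => i; rewrite !mxE le_max lexx orbT //.
have normF_ge0 : 0 <= `|F x| ^+ 2 by rewrite exprn_ge0.
have growthF := growth _ normF_ge0.
have c2_gt0 : 0 < c / 2 by rewrite divr_gt0.
have middle_le : (middle <= L)%E.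
  rewrite /middle /L /aug_lagr.
  case: ifPn => [|_]; last exact: leey.
  rewrite inE => -[b_gt0 phi_lty].
  rewrite -/(qvec g psi x mu c); set q := qvec _ _ _ _ _.
  have phi_fin : phi (`|F x| ^+ 2) \is a fin_num.
    by rewrite ge0_fin_numE // (phi_ge0 phi_cond).
  move: growthF; rewrite -(fineK phi_fin); set P := fine _; rewrite lee_fin => growthF.
  rewrite -!EFinM -!EFinD lee_fin.
  have youngF : - (1 / (2 * c * phi0)) <=
      c / 2 * `|lambda| ^+ 2 * P + '[lambda, F x].
    rewrite -(mulrA 2 c phi0).
    have young := scaled_young _ _ _ _ (mulr_gt0 c_gt0 phi0_gt0)
      (inner_cauchy_schwarz _ _ lambda (F x)).
    apply: (le_trans young).
    rewrite lerD2r.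
    (* Regrouping exposes [phi0 * |F x|^2], which [growthF] bounds by [P]. *)
    have -> : c * phi0 / 2 * (`|lambda| ^+ 2 * `|F x| ^+ 2) =
        c / 2 * `|lambda| ^+ 2 * (phi0 * `|F x| ^+ 2) by ring.
    by rewrite ler_wpM2l // mulr_ge0 ?exprn_ge0 // ltW.
  have youngq : - (psi 0 / (2 * c)) <=
      c / (2 * b) * (enorm mu ^+ 2 * enorm q ^+ 2) + edot mu q.
    have -> : c / (2 * b) = c / b / 2 by field; rewrite gt_eqF.
    have young := scaled_young _ _ _ _ (divr_gt0 c_gt0 b_gt0)
      (edot_cauchy_schwarz mu q).
    apply: le_trans young.
    (* The square leaves the constant [b / (2 * c)], and [b_le] replaces [b] by [psi 0]. *)
    have -> : 1 / (2 * (c / b)) = b / (2 * c) by field; rewrite !gt_eqF.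
    by rewrite lerN2 ler_pM2r // invr_gt0 mulr_gt0.
  (* Since [1/p = (1 + |mu|^2) / b], the penalty splits into the term kept in [middle] and the one
     consumed by [youngq]. *)
  have -> : c / (2 * pfun g psi x mu) * enorm q ^+ 2 =
      c / (2 * b) * enorm q ^+ 2 + c / (2 * b) * (enorm mu ^+ 2 * enorm q ^+ 2).
    rewrite /pfun -/b; field; rewrite gt_eqF //= gt_eqF //.
    by rewrite ltr_pwDl // sqr_ge0.
  move: youngF youngq; rewrite -/b; lra.
have lower_le : 0 < b -> (lower <= middle)%E.
  move=> b_gt0; rewrite /middle /lower.
  rewrite -/(qvec g psi x mu c); set q := qvec _ _ _ _ _.
  have max_le : c / (2 * psi 0) * enorm (vmax (gvec g x) 0) ^+ 2 <=
      c / (2 * b) * enorm q ^+ 2.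
    apply: ler_pM; rewrite ?exprn_ge0 ?sqrtr_ge0 //.
    - by rewrite ltW // divr_gt0 // mulr_gt0.
    - by rewrite ler_pM2l // lef_pV2 ?posrE ?mulr_gt0 // ler_pM2l.
    - exact: enorm_vmax0_le.
  have const_le : psi 0 / (2 * c) <= (1 + m%:R) * psi 0 / (2 * c).
    rewrite ler_pM2r ?invr_gt0 ?mulr_gt0 // mulrDl mul1r lerDl.
    by rewrite mulr_ge0 // ltW.
  (* The value of [phi] may be [+oo] here, so the sums are compared term by term in the extended
     reals. *)
  rewrite leeD2r // leeB ?lee_fin // leeD2l // lee_fin.
(* For [b > 0] the two bounds chain; for [b <= 0] the point lies outside [Omega], so [L] is
   [+oo]. *)
split=> //; have [b_gt0|b_le0] := ltP 0 b.
  exact: le_trans (lower_le b_gt0) middle_le.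
rewrite /L /aug_lagr ifF ?leey //; apply/negbTE; rewrite notin_setE => -[].
by rewrite ltNge -/b b_le0.
Qed.
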